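(* Assume: (i) both SVRG and SGD use the constant step size $c_0>0$ with $c_0\le\big(\max(\max_i\|a_i\|^2,\|B\|^2)\big)^{-1}$; (iii) $A=\Sigma V^t$ with $\Sigma\in\mathbb{R}^{n\times m}$ diagonal with nonnegative entries and $V\in\mathbb{R}^{m\times m}$ with orthonormal columns. Let $c'_B=(1-c_0\|B\|)^{-2(M-1)}$ and suppose $$(M-1)^2c_0^2\|B\|^2\le(2c'_B)^{-1}\quad\text{and}\quad (M+1)^2\le(2c'_B)^{-1}(n-1).$$ For any integer $K\ge 0$, let the random matrix $R_1\in\mathbb{R}^{m\times m}$ and the random vector $R_2\in\mathbb{R}^m$ be measurable with respect to $\mathcal{F}^c_{KM}$, where $R_1$ is a combination (a finite linear combination of finite products) of $M_0$ and matrices $H_k$. Then $$\mathbb{E}\big[\|R_1(e_{KM}^\delta-B^{-1}\zeta)+R_2\|^2\big]\le\mathbb{E}\big[\|R_1(\hat e_{KM}^\delta-B^{-1}\zeta)+R_2\|^2\big].$$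
   Context: Let $n,m,M\ge 1$ be integers, $A\in\mathbb{R}^{n\times m}$ with $i$-th row $a_i^t$, $x_0\in\mathbb{R}^m$, $y^\dagger$ in the range of $A$, $x^\dagger=\arg\min\{\|x-x_0\|: Ax=y^\dagger\}$, and $y^\delta=y^\dagger+\xi$ with fixed noise $\xi\in\mathbb{R}^n$. $\|\cdot\|$ is the Euclidean/spectral norm. Let $B=n^{-1}A^tA$, assumed throughout to satisfy $\|B\|\le1$, $M_0=I-c_0B$, and $\zeta=n^{-1}A^t\xi$. $B^{-1}$ is understood as the Moore–Penrose inverse if $B$ is singular (note $\zeta$ lies in the range of $B$). Let $i_0,i_1,\dots$ be i.i.d. uniform on $\{1,\dots,n\}$; $\mathcal{F}_k$ is the $\sigma$-algebra generated by $i_0,\dots,i_{k-1}$, and $\mathcal{F}_k^c$ that generated by $i_k,i_{k+1},\dots$. Let $J'(x)=n^{-1}A^t(Ax-y^\delta)$ and $k_M=\lfloor k/M\rfloor M$. SVRG: $x_0^\delta=x_0$, $x_{k+1}^\delta=x_k^\delta-c_0\big((a_{i_k},x_k^\delta-x_{k_M}^\delta)a_{i_k}+J'(x_{k_M}^\delta)\big)$; $e_k^\delta=x_k^\delta-x^\dagger$. SGD: $\hat x_0^\delta=x_0$, $\hat x_{k+1}^\delta=\hat x_k^\delta-c_0\big((a_{i_k},\hat x_k^\delta)-y_{i_k}^\delta\big)a_{i_k}$; $\hat e_k^\delta=\hat x_k^\delta-x^\dagger$. Let $P_k=I-c_0a_{i_k}a_{i_k}^t$ and $N_k=B-a_{i_k}a_{i_k}^t$.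 Set $G_k=I$ if $k$ is a multiple of $M$, and otherwise $G_k=P_{k_M+M-1}P_{k_M+M-2}\cdots P_{k}$ (so $G_k=G_{k+1}P_k$). Define $H_k=G_{k+1}N_k$. *)

(* Defs.v *)
From HB Require Import structures.
From mathcomp Require Import all_boot all_order all_algebra.
From mathcomp Require Import all_classical all_reals all_analysis.

Set Implicit Arguments.
Unset Strict Implicit.
Unset Printing Implicit Defensive.

Import Order.TTheory GRing.Theory Num.Theory.
Import numFieldNormedType.Exports.

Local Open Scope classical_set_scope.
Local Open Scope ring_scope.

Section LinearAlgebra.
Context {R : realType}.

(* The library norm on matrices is the max norm, hence these definitions. *)
Definition enorm (p : nat) (x : 'cV[R]_p) : R :=
  Num.sqrt (\sum_(i < p) x i 0 ^+ 2).

Definition opnorm (p q : nat) (T : 'M[R]_(p, q)) : R :=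
  sup [set enorm (T *m x) | x in [set x : 'cV[R]_q | enorm x <= 1]].

Definition is_moore_penrose (p q : nat) (T : 'M[R]_(p, q)) (X : 'M[R]_(q, p)) :
    Prop :=
  [/\ T *m X *m T = T, X *m T *m X = X,
      (T *m X)^T = T *m X & (X *m T)^T = X *m T].

Lemma moore_penrose_unique (p q : nat) (T : 'M[R]_(p, q)) (X Y : 'M[R]_(q, p)) :
  is_moore_penrose T X -> is_moore_penrose T Y -> X = Y.
Proof.
move=> [X1 X2 X3 X4] [Y1 Y2 Y3 Y4].
have TXY : T *m X = T *m Y.
  rewrite -[LHS]X3 -{1}Y1 -[T *m Y *m T *m X]mulmxA trmx_mul X3 Y3.
  by rewrite mulmxA X1.
have XTY : X *m T = Y *m T.
  rewrite -[LHS]X4 -{1}Y1 -[T *m Y *m T]mulmxA mulmxA trmx_mul X4 Y4.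
  by rewrite -mulmxA [T *m (X *m T)]mulmxA X1.
by rewrite -X2 -mulmxA TXY mulmxA XTY Y2.
Qed.

(* The default 0 of [xget] is never used: every real matrix has a Moore-Penrose
   inverse. *)
Definition mp_inverse (p q : nat) (T : 'M[R]_(p, q)) : 'M[R]_(q, p) :=
  xget 0 [set X | is_moore_penrose T X].

End LinearAlgebra.

Section LeastSquares.
Context {R : realType} {n m : nat}.
Variable A : 'M[R]_(n, m).

Definition arow (i : 'I_n) : 'cV[R]_m := (row i A)^T.

Definition inner (p : nat) (x y : 'cV[R]_p) : R := \sum_(j < p) x j 0 * y j 0.

Definition Bmat : 'M[R]_m := n%:R^-1 *: (A^T *m A).

Definition zeta (xi : 'cV[R]_n) : 'cV[R]_m := n%:R^-1 *: (A^T *m xi).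

Definition max_row_norm2 : R := \big[Num.max/0]_(i < n) enorm (arow i) ^+ 2.

Definition min_dist_solution (x0 : 'cV[R]_m) (y : 'cV[R]_n) (x : 'cV[R]_m) :
    Prop :=
  A *m x = y /\ (forall z, A *m z = y -> enorm (x - x0) <= enorm (z - x0)).

Definition gradJ (y : 'cV[R]_n) (x : 'cV[R]_m) : 'cV[R]_m :=
  n%:R^-1 *: (A^T *m (A *m x - y)).

Definition epoch_start (M k : nat) : nat := (k %/ M * M)%N.

(* [i] is one realization of the random index sequence. *)
Definition svrg_iterates (y : 'cV[R]_n) (x0 : 'cV[R]_m) (c0 : R) (M : nat)
    (i : nat -> 'I_n) (x : nat -> 'cV[R]_m) : Prop :=
  x 0%N = x0 /\
  (forall k, x k.+1 = x k - c0 *: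
     (inner (arow (i k)) (x k - x (epoch_start M k)) *: arow (i k)
      + gradJ y (x (epoch_start M k)))).

Definition sgd_iterates (y : 'cV[R]_n) (x0 : 'cV[R]_m) (c0 : R)
    (i : nat -> 'I_n) (x : nat -> 'cV[R]_m) : Prop :=
  x 0%N = x0 /\
  (forall k, x k.+1 = x k - c0 *:
     ((inner (arow (i k)) (x k) - y (i k) 0) *: arow (i k))).

Definition M0mat (c0 : R) : 'M[R]_m := 1%:M - c0 *: Bmat.

Definition Pmat (c0 : R) (i : nat -> 'I_n) (k : nat) : 'M[R]_m :=
  1%:M - c0 *: (arow (i k) *m (arow (i k))^T).

Definition Nmat (i : nat -> 'I_n) (k : nat) : 'M[R]_m :=
  Bmat - arow (i k) *m (arow (i k))^T.

(* The reversed range puts the largest index on the left of the product. *)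
Definition Gmat (c0 : R) (M : nat) (i : nat -> 'I_n) (k : nat) : 'M[R]_m :=
  if (M %| k)%N then 1%:M
  else \big[mulmx/1%:M]_(j <- rev (index_iota k (epoch_start M k + M)))
         Pmat c0 i j.

Definition Hmat (c0 : R) (M : nat) (i : nat -> 'I_n) (k : nat) : 'M[R]_m :=
  Gmat c0 M i k.+1 *m Nmat i k.

Definition cB (c0 : R) (M : nat) : R := (1 - c0 * opnorm Bmat) ^- (2 * M.-1).

(* A word over [option nat] encodes a finite product: [None] stands for M_0 and
   [Some k] for H_k.  The shape and the coefficients of the combination are
   deterministic. *)
Definition combination_M0_H (Omega : Type) (c0 : R) (M : nat)
    (idx : nat -> Omega -> 'I_n) (R1 : Omega -> 'M[R]_m) : Prop :=
  exists s : seq (R * seq (option nat)), forall w,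
    R1 w = \sum_(t <- s) t.1 *: \big[mulmx/1%:M]_(l <- t.2)
             (if l is Some k then Hmat c0 M (idx ^~ w) k else M0mat c0).

End LeastSquares.

Section Sampling.
Context {d : measure_display} {Omega : measurableType d} {R : realType}.
Context {n : nat}.
Variables (P : probability Omega R) (idx : nat -> Omega -> 'I_n).

Definition iid_uniform : Prop :=
  [/\ forall k (E : set 'I_n), measurable (idx k @^-1` E),
      forall k j, P (idx k @^-1` [set j]) = (n%:R^-1)%:E
    & forall (J : seq nat) (E : nat -> set 'I_n), uniq J ->
        P (\big[setI/setT]_(k <- J) (idx k @^-1` E k))
        = (\prod_(k <- J) P (idx k @^-1` E k))%E].

Definition tail_sigma (k : nat) : set (set Omega) :=
  <<s [set D | exists l (E : set 'I_n), (k <= l)%N /\ D = idx l @^-1` E] >>.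

(* The Borel sigma-algebra of real matrices is the product one, so that
   measurability is entrywise. *)
Definition measurable_mx_wrt (F : set (set Omega)) (p q : nat)
    (X : Omega -> 'M[R]_(p, q)) : Prop :=
  forall i j (D : set R), measurable D -> F ((fun w => X w i j) @^-1` D).

End Sampling.

(* Main.v *)
Require Import Defs.
From HB Require Import structures.
From mathcomp Require Import all_boot all_order all_algebra.
From mathcomp Require Import all_classical all_reals all_analysis.
From mathcomp Require Import measurable_realfun ring lra.

Set Implicit Arguments.
Unset Strict Implicit.
Unset Printing Implicit Defensive.

Import Order.TTheory GRing.Theory Num.Theory.
Import numFieldNormedType.Exports.

Local Open Scope classical_set_scope.
Local Open Scope ring_scope.

(** In the basis V every a_i a_i^t is diagonal with at most one nonzero entry, and
    R_1 is diagonal as well, so the squared norm splits into scalar problems, one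
    per coordinate.  There, with h in {0, c_0 sigma_j^2} the random step and q its
    mean, SGD is u' = (1 - h) u and SVRG is u' = (1 - h) u + (h - q) r, where r is
    the value at the start of the epoch.  Both have the same mean, and the extra
    term changes the second moment of SVRG by -Var(h) (2 E[u r] - E[r^2]).  Within
    an epoch E[u r] = (1 - q)^l E[r^2] with l < M, and the hypothesis on n makes
    (1 - q)^(M-1) at least 1/2, so this change is nonpositive.  Since R_1 and R_2
    are independent of the first K M indices, comparing first and second moments
    for fixed values of R_1 and R_2 is enough. *)

(** * Expectations over finite words of uniform draws *)

Section WordMean.
Context {R : realFieldType} {n : nat}.
Implicit Types (f g : seq 'I_n -> R) (N : nat).

Definition mean (a : 'I_n -> R) : R := n%:R^-1 * \sum_i a i.

(** The expectation of [f] over [N] independent uniform draws. The head letter is averaged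
    innermost: when words list the latest draw first, one unfolding is the conditional expectation
    given the earlier draws. *)
Fixpoint wmean N f : R :=
  if N is N'.+1 then wmean N' (fun s => mean (fun i => f (i :: s))) else f [::].

Lemma meanD (a b : 'I_n -> R) : mean (fun i => a i + b i) = mean a + mean b.
Proof. by rewrite /mean big_split mulrDr. Qed.

Lemma meanZ c (a : 'I_n -> R) : mean (fun i => c * a i) = c * mean a.
Proof. by rewrite /mean -mulr_sumr mulrCA. Qed.

Lemma mean_cst c : (0 < n)%N -> mean (fun=> c) = c.
Proof.
move=> n0; rewrite /mean sumr_const card_ord -[c *+ n]mulr_natl mulrA mulVf ?mul1r //.
by rewrite pnatr_eq0 -lt0n.
Qed.

Lemma eq_mean (a b : 'I_n -> R) : a =1 b -> mean a = mean b.
Proof. by move=> ab; rewrite /mean (eq_bigr b). Qed.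

Lemma le_mean (a b : 'I_n -> R) : (forall i, a i <= b i) -> mean a <= mean b.
Proof.
by move=> ab; rewrite /mean ler_wpM2l ?invr_ge0// ler_sum.
Qed.

(** Only words of length [N] are compared, because the position within an epoch is read off the
    length. *)
Lemma le_wmean N f g :
  (forall s, size s = N -> f s <= g s) -> wmean N f <= wmean N g.
Proof.
elim: N f g => [|N IH] f g fg /=; first exact: fg.
by apply: IH => s sN; apply: le_mean => i; apply: fg; rewrite /= sN.
Qed.

Lemma eq_wmean N f g :
  (forall s, size s = N -> f s = g s) -> wmean N f = wmean N g.
Proof.
by move=> fg; apply: le_anti; rewrite !le_wmean // => s /fg ->.
Qed.

Lemma wmeanD N f g : wmean N (fun s => f s + g s) = wmean N f + wmean N g.
Proof.
elim: N f g => [//|N IH] f g /=.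
by rewrite -IH; apply: eq_wmean => s _; rewrite meanD.
Qed.

Lemma wmeanZ N c f : wmean N (fun s => c * f s) = c * wmean N f.
Proof.
elim: N f => [//|N IH] f /=.
by rewrite -IH; apply: eq_wmean => s _; rewrite meanZ.
Qed.

Lemma wmean_cst N c : (0 < n)%N -> wmean N (fun=> c) = c.
Proof.
move=> n0; elim: N => //= N IH; rewrite -[RHS]IH.
by apply: eq_wmean => s _; rewrite mean_cst.
Qed.

Lemma wmean_sum N (I : Type) (r : seq I) (F : I -> seq 'I_n -> R) :
  wmean N (fun s => \sum_(k <- r) F k s) = \sum_(k <- r) wmean N (F k).
Proof.
elim: N F => [|N IH] F //=.
rewrite -IH; apply: eq_wmean => s _.
by rewrite /mean exchange_big mulr_sumr.
Qed.

Lemma wmean_mean N (F : 'I_n -> seq 'I_n -> R) :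
  wmean N (fun s => mean (F ^~ s)) = mean (fun i => wmean N (F i)).
Proof. by rewrite /mean wmeanZ wmean_sum. Qed.

Lemma wmean_ge0 N f : (forall s, 0 <= f s) -> 0 <= wmean N f.
Proof.
elim: N f => [|N IH] f f0 /=; [exact: f0|apply: IH => s].
by rewrite /mean mulr_ge0 ?invr_ge0// sumr_ge0.
Qed.

End WordMean.

Definition history (T : Type) (i : nat -> T) k : seq T :=
  rev [seq i l | l <- iota 0 k].

Lemma historyS (T : Type) (i : nat -> T) k :
  history i k.+1 = i k :: history i k.
Proof. by rewrite /history -addn1 iotaD map_cat rev_cat. Qed.

Lemma size_history (T : Type) (i : nat -> T) k : size (history i k) = k.
Proof. by rewrite size_rev size_map size_iota. Qed.

(** * First and second moments of the scalar recursions *)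

Section ScalarRecursion.
Context {R : realFieldType} {n : nat}.
Variables (M : nat) (h : 'I_n -> R) (z : R).

Let q := mean h.

(* Words list the drawn indices from the latest to the earliest; the second
   component is the iterate at the start of the current epoch. *)
Fixpoint svrg_state (s : seq 'I_n) : R * R :=
  if s is i :: s' then
    let: (u, r) := svrg_state s' in
    let u' := (1 - h i) * u + (h i - q) * r in
    (u', if (M %| size s)%N then u' else r)
  else (z, z).

Definition svrg_coord s := (svrg_state s).1.
Definition svrg_ref s := (svrg_state s).2.

Fixpoint sgd_coord (s : seq 'I_n) : R :=
  if s is i :: s' then (1 - h i) * sgd_coord s' else z.

Lemma svrg_coord_cons i s :
  svrg_coord (i :: s) =
  (1 - h i) * svrg_coord s + (h i - q) * svrg_ref s.
Proof. by rewrite /svrg_coord /svrg_ref /=; case: svrg_state. Qed.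

Lemma svrg_ref_cons i s :
  svrg_ref (i :: s) =
  if (M %| (size s).+1)%N then svrg_coord (i :: s) else svrg_ref s.
Proof. by rewrite /svrg_coord /svrg_ref /=; case: svrg_state. Qed.

Hypothesis n_gt0 : (0 < n)%N.

(** The control variate [(h i - q) * r] has mean zero. At [r = 0] this is the SGD step. *)
Lemma mean_svrg_step (u r : R) :
  mean (fun i => (1 - h i) * u + (h i - q) * r) = (1 - q) * u.
Proof.
rewrite (eq_mean (b := fun i => (u - q * r) + (r - u) * h i)); last first.
  by move=> i; ring.
by rewrite meanD mean_cst // meanZ -/q; ring.
Qed.

(** Each draw multiplies either mean by [1 - q]. *)
Lemma wmean_svrg_sgd N : wmean N svrg_coord = wmean N sgd_coord.
Proof.
have svrgE k : wmean k svrg_coord = (1 - q) ^+ k * z.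
  elim: k => [|k IH]; first by rewrite expr0 mul1r.
  rewrite /= exprS -mulrA -IH -wmeanZ; apply: eq_wmean => s _.
  rewrite -(mean_svrg_step _ (svrg_ref s)).
  by apply: eq_mean => i; rewrite svrg_coord_cons.
rewrite svrgE; elim: N => [|k IH]; first by rewrite expr0 mul1r.
rewrite /= exprS -mulrA IH -wmeanZ; apply: eq_wmean => s _.
by rewrite -(mean_svrg_step _ 0); apply: eq_mean => i /=; rewrite mulr0 addr0.
Qed.

Hypothesis M_gt0 : (0 < M)%N.

(** Within an epoch the reference is frozen while the conditional mean of the iterate contracts by
    [1 - q] per draw. At an epoch boundary the two coincide and the exponent restarts at 0. *)
Lemma wmean_svrg_ref N :
  wmean N (fun s => svrg_coord s * svrg_ref s) =
  (1 - q) ^+ (N %% M) * wmean N (fun s => svrg_ref s ^+ 2).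
Proof.
elim: N => [|N IH]; first by rewrite mod0n expr0 mul1r.
have [MN|MN] := boolP (M %| N.+1)%N.
  rewrite (eqP MN) expr0 mul1r; apply: eq_wmean => -[//|i s] [sN].
  by rewrite svrg_ref_cons sN MN expr2.
have -> : (N.+1 %% M = (N %% M).+1)%N.
  by rewrite modnS (negbTE MN).
transitivity ((1 - q) * wmean N (fun s => svrg_coord s * svrg_ref s)).
  rewrite -wmeanZ /=; apply: eq_wmean => s sN.
  rewrite mulrA -(mean_svrg_step _ (svrg_ref s)) mulrC -meanZ.
  apply: eq_mean => i; rewrite svrg_ref_cons sN (negbTE MN) svrg_coord_cons.
  by rewrite mulrC.
rewrite IH exprS mulrA; congr (_ * _) => /=; apply: eq_wmean => s sN.
rewrite -[LHS](mean_cst _ n_gt0); apply: eq_mean => i.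
by rewrite svrg_ref_cons sN (negbTE MN).
Qed.

Hypothesis half_le : 1 / 2 <= (1 - q) ^+ M.-1.
Hypothesis q_ge0 : 0 <= q.
Hypothesis q_le1 : q <= 1.

(** A position within an epoch is at most [M - 1], and powers of [1 - q] decrease. *)
Lemma half_le_pow N : 1 / 2 <= (1 - q) ^+ (N %% M).
Proof.
apply: le_trans half_le _; apply: ler_wiXn2l; rewrite ?subr_ge0 ?gerBl //.
by rewrite -ltnS prednK // ltn_mod.
Qed.

(* Writing v for the variance of h and lam for the mean of (1 - h)^2, one step
   maps the second moment of u to lam E[u^2] - v (2 E[u r] - E[r^2]). *)
Lemma wmean_svrg_sq_le N :
  wmean N (fun s => svrg_coord s ^+ 2) <= wmean N (fun s => sgd_coord s ^+ 2).
Proof.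
elim: N => [//|N IH].
set lam := mean (fun i => (1 - h i) ^+ 2).
set v := mean (fun i => (h i - q) ^+ 2).
have lam0 : 0 <= lam.
  by rewrite /lam /mean mulr_ge0 ?invr_ge0// sumr_ge0// => i _; exact: sqr_ge0.
have v0 : 0 <= v.
  by rewrite /v /mean mulr_ge0 ?invr_ge0// sumr_ge0// => i _; exact: sqr_ge0.
have -> : wmean N.+1 (fun s => sgd_coord s ^+ 2) =
          lam * wmean N (fun s => sgd_coord s ^+ 2).
  rewrite -wmeanZ /=; apply: eq_wmean => s _.
  by rewrite mulrC -meanZ; apply: eq_mean => i; ring.
have -> : wmean N.+1 (fun s => svrg_coord s ^+ 2) =
    lam * wmean N (fun s => svrg_coord s ^+ 2) +
    (- v) * (2 * wmean N (fun s => svrg_coord s * svrg_ref s) +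
             (- 1) * wmean N (fun s => svrg_ref s ^+ 2)).
  rewrite -!wmeanZ -wmeanD -!wmeanZ -wmeanD /=; apply: eq_wmean => s _.
  set u := svrg_coord s; set r := svrg_ref s.
  (* Writing [1 - h] as [(1 - q) - (h - q)] leaves only the variance, as [h - q] has mean zero. *)
  have E : mean (fun i => (1 - h i) * (h i - q)) = - v.
    rewrite (eq_mean (b := fun i => (- 1) * (h i - q) ^+ 2 +
                                    ((1 - q) * h i + (1 - q) * (- q)))); last first.
      by move=> i; ring.
    by rewrite !meanD !meanZ mean_cst // -/q -/v; ring.
  transitivity (mean (fun i => u ^+ 2 * (1 - h i) ^+ 2 +
     (2 * u * r * ((1 - h i) * (h i - q)) + r ^+ 2 * (h i - q) ^+ 2))).
    by apply: eq_mean => i; rewrite svrg_coord_cons -/u -/r; ring.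
  by rewrite !meanD !meanZ E -/lam -/v; ring.
apply: le_trans (ler_wpM2l lam0 IH).
rewrite gerDl mulN1r mulNr oppr_le0 mulr_ge0 // wmean_svrg_ref.
set W := wmean N (fun s => svrg_ref s ^+ 2).
have W0 : 0 <= W by apply: wmean_ge0 => s; exact: sqr_ge0.
have := ler_wpM2r W0 (half_le_pow N); lra.
Qed.

(** After expanding the square, the linear terms agree by equality of means and the quadratic ones
    compare with weight [a ^+ 2]. *)
Lemma wmean_affine_sq_le N (a g : R) :
  wmean N (fun s => (a * svrg_coord s + g) ^+ 2) <=
  wmean N (fun s => (a * sgd_coord s + g) ^+ 2).
Proof.
have E f : wmean N (fun s : seq 'I_n => (a * f s + g) ^+ 2) =
    a ^+ 2 * wmean N (fun s => f s ^+ 2) + (2 * a * g * wmean N f + g ^+ 2).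
  rewrite -(wmean_cst N (g ^+ 2) n_gt0) -!wmeanZ -!wmeanD.
  by apply: eq_wmean => s _; ring.
by rewrite !E wmean_svrg_sgd lerD2r ler_wpM2l ?sqr_ge0 ?wmean_svrg_sq_le.
Qed.

End ScalarRecursion.

(** * Averaging out independent indices under the integral *)

(** A nonnegative integral is the integral of the identity against the law on the open half-line,
    since the value 0 contributes nothing. Hence the laws need only be compared away from 0. *)
Lemma eq_integral_law {d} {T : measurableType d} {R : realType}
    (P : probability T R) (r : {nonneg R}) (g f : T -> R) :
  measurable_fun setT g -> measurable_fun setT f ->
  (forall w, 0 <= g w) -> (forall w, 0 <= f w) ->
  (forall D : set R, measurable D -> D `<=` `]0%R, +oo[ ->
     P (g @^-1` D) = r%:num%:E * P (f @^-1` D))%E ->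
  (\int[P]_w (g w)%:E = r%:num%:E * \int[P]_w (f w)%:E)%E.
Proof.
move=> mg mf g0 f0 gf.
have law (h : T -> R) : measurable_fun setT h -> (forall w, 0 <= h w) ->
    (\int[P]_w (h w)%:E = \int[pushforward P h]_(y in `]0%R, +oo[) y%:E)%E.
  move=> mh h0; rewrite (ge0_integral_pushforward mh) //=.
  - rewrite [RHS]integral_mkcond; apply: eq_integral => w _.
    rewrite patchE; case: ifPn => //; rewrite notin_setE /= in_itv /= andbT.
    by move=> /negP; rewrite -leNgt => hw; congr EFin; apply/eqP; rewrite eq_le hw h0.
  - by move=> y; rewrite inE /= in_itv /= andbT lee_fin; exact: ltW.
rewrite (law g) // (law f) //.
pose m : {measure set R -> \bar R} := pushforward P f.
rewrite -(ge0_integral_mscale (m mf)) //=.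
  by apply: eq_measure_integral => D mD D0; exact: gf.
by move=> y; rewrite /= in_itv /= andbT lee_fin; exact: ltW.
Qed.

Section Sampling.
Context {d : measure_display} {Omega : measurableType d} {R : realType}.
Context {n : nat} (P : probability Omega R) (idx : nat -> Omega -> 'I_n).
Hypothesis idx_iid : iid_uniform P idx.

Let tail_gen k : set (set Omega) :=
  [set D | exists l (E : set 'I_n), (k <= l)%N /\ D = idx l @^-1` E].

(** Measurability on [Omega] carrying the tail sigma-algebra, so that the usual closure properties
    of measurable functions apply directly. *)
Definition tail_measurable (k : nat) (f : Omega -> R) :=
  measurable_fun setT (f : g_sigma_algebraType (tail_gen k) -> R).

Lemma tail_sigma_measurable k : tail_sigma idx k `<=` measurable.
Proof.
apply: smallest_sub; first exact: sigma_algebra_measurable.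
by move=> _ [l [E [_ ->]]]; case: idx_iid => + _ _; exact.
Qed.

Lemma tail_sigmaS k : tail_sigma idx k.+1 `<=` tail_sigma idx k.
Proof.
apply: sub_sigma_algebra2 => D [l [E [kl ->]]]; exists l, E; split => //.
exact: ltnW.
Qed.

Lemma tail_measurableP k f :
  tail_measurable k f <->
  (forall D : set R, measurable D -> tail_sigma idx k (f @^-1` D)).
Proof.
by split=> [mf D mD|mf _ D mD]; [rewrite -[_ @^-1` _]setTI; exact: mf|
  rewrite setTI; exact: mf].
Qed.

Lemma tail_measurableS k f : tail_measurable k.+1 f -> tail_measurable k f.
Proof.
by move=> /tail_measurableP mf; apply/tail_measurableP => D /mf /tail_sigmaS.
Qed.

Lemma tail_measurableW k f : tail_measurable k f -> measurable_fun setT f.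
Proof.
move=> /tail_measurableP mf _ D /mf; rewrite setTI; exact: tail_sigma_measurable.
Qed.

Lemma tail_measurable_select k (F : 'I_n -> Omega -> R) :
  (forall i, tail_measurable k (F i)) ->
  tail_measurable k (fun w => F (idx k w) w).
Proof.
move=> mF; have -> : (fun w => F (idx k w) w) =
    (fun w => \sum_(i <- enum 'I_n) (\1_(idx k @^-1` [set i]) w * F i w)).
  apply/funext => w; rewrite big_enum /= (bigD1 (idx k w)) //= big1 ?addr0.
    by rewrite indicE mem_set ?mul1r.
  move=> i ik; rewrite indicE memNset ?mul0r //= => E.
  by rewrite E eqxx in ik.
apply: measurable_sum => i; apply: measurable_funM; last exact: mF.
apply: measurable_indic; apply: sub_sigma_algebra.
by exists k, [set i].
Qed.

(** Both sides are finite measures in [D]. They agree on finite cylinders by independence, and the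
    cylinders form a pi-system generating the tail. *)
Lemma probability_idx_tail k i D : tail_sigma idx k.+1 D ->
  (P (idx k @^-1` [set i] `&` D) = n%:R^-1%:E * P D)%E.
Proof.
move=> tD; have mi : measurable (idx k @^-1` [set i]).
  by case: idx_iid => + _ _; exact.
pose G := [set D | exists L (E : nat -> set 'I_n),
  D = \big[setI/setT]_(l <- iota k.+1 L) (idx l @^-1` E l)].
have bigE L E w : (\big[setI/setT]_(l <- iota k.+1 L) (idx l @^-1` E l)) w <->
    forall l, (k < l < k.+1 + L)%N -> E l (idx l w).
  rewrite -bigcap_seq; split => [H l kl|H l /=].
    by apply: (H l) => /=; rewrite mem_iota.
  by rewrite mem_iota => kl; apply: H.
have GT : G setT by exists 0%N, (fun=> setT); rewrite big_nil.
have r0 : 0 <= n%:R^-1 :> R by [].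
pose m1 := mrestr P mi; pose m2 := mscale (NngNum r0) P.
suff /(_ D tD) : forall E, tail_sigma idx k.+1 E -> m1 E = m2 E.
  by rewrite /m1 /m2 /mrestr /mscale setIC.
have sub : tail_sigma idx k.+1 `<=` <<s G >>.
  apply: smallest_sub; first exact: smallest_sigma_algebra.
  move=> _ [l [E [kl ->]]]; apply: sub_sigma_algebra.
  (* The run of length [l - k] starting at [k.+1] ends exactly at [l]. *)
  exists (l - k)%N, (fun j => if j == l then E else setT).
  rewrite eqEsubset; split => w /=.
    by move=> Ew; apply/bigE => j _; case: eqP => // ->.
  move=> /bigE /(_ l); rewrite eqxx; apply.
  by rewrite kl addSn subnKC ?ltnSn // ltnW.
move=> E /sub; move: E; apply: (g_sigma_algebra_measure_unique G _ (fun=> setT)) => //.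
- move=> _ [L [E ->]]; apply: bigsetI_measurable => l _.
  by case: idx_iid => + _ _; exact.
- by rewrite bigcup_const.
- move=> _ _ [L1 [E1 ->]] [L2 [E2 ->]].
  exists (maxn L1 L2), (fun l => (if (l < k.+1 + L1)%N then E1 l else setT) `&`
                          (if (l < k.+1 + L2)%N then E2 l else setT)).
  rewrite eqEsubset; split => w /=.
    move=> [/bigE H1 /bigE H2]; apply/bigE => l /andP[kl _].
    by split; case: ifP => // lL; [apply: H1|apply: H2]; rewrite kl.
  move=> /bigE H; split; apply/bigE => l /andP[kl lL].
    have [|+ _] := H l; last by rewrite lL.
    by rewrite kl /= (leq_trans lL) // leq_add2l leq_maxl.
  have [|_] := H l; last by rewrite lL.
  by rewrite kl /= (leq_trans lL) // leq_add2l leq_maxr.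
- move=> _ [L [E ->]]; case: idx_iid => _ uni ind.
  rewrite /= /mrestr /mscale /= setIC.
  (* Prescribing the value [i] at time [k] gives a single cylinder on [k :: iota k.+1 L], to which
     independence applies. *)
  pose E' l := if l == k then [set i] else E l.
  have eqE l : l \in iota k.+1 L -> E' l = E l.
    by rewrite mem_iota /E'; case: eqP => // ->; rewrite ltnn.
  have := ind (k :: iota k.+1 L) E' (iota_uniq k L.+1).
  have -> : idx k @^-1` [set i] = idx k @^-1` E' k by rewrite /E' eqxx.
  rewrite !big_cons (eq_big_seq (fun l => idx l @^-1` E l)); last first.
    by move=> l /eqE ->.
  move=> ->; rewrite {1}/E' eqxx uni.
  rewrite (eq_big_seq (fun l => P (idx l @^-1` E l))); last first.
    by move=> l /eqE ->.
  by rewrite -(ind _ E (iota_uniq k.+1 L)).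
- by move=> _; rewrite /= /mrestr setTI (le_lt_trans (probability_le1 _ _)) ?ltry.
Qed.

Lemma tail_measurable_mean k (F : 'I_n -> Omega -> R) :
  (forall i, tail_measurable k (F i)) ->
  tail_measurable k (fun w => mean (F ^~ w)).
Proof.
move=> mF; apply: (measurable_funM (f := cst n%:R^-1)); first exact: measurable_cst.
exact: (measurable_sum _ mF).
Qed.

Lemma tail_measurable_wmean k N (F : seq 'I_n -> Omega -> R) :
  (forall s, tail_measurable k (F s)) ->
  tail_measurable k (fun w => wmean N (F ^~ w)).
Proof.
elim: N F => [|N IH] F mF; first exact: mF.
by apply: (IH (fun s w => mean (fun i => F (i :: s) w))) => s;
  apply: (tail_measurable_mean (F := fun i => F (i :: s))).
Qed.

(** The integrand splits over the values of [idx k]. Away from 0, independence gives the piece for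
    [i] the law of [F i] times 1/n. *)
Lemma integral_select k (F : 'I_n -> Omega -> R) :
  (forall i, tail_measurable k.+1 (F i)) -> (forall i w, 0 <= F i w) ->
  (\int[P]_w (F (idx k w) w)%:E = \int[P]_w (mean (F ^~ w))%:E)%E.
Proof.
move=> mF F0.
have mi i : measurable (idx k @^-1` [set i]) by case: idx_iid => + _ _; exact.
have mFT i : measurable_fun setT (F i) by exact: (tail_measurableW (mF i)).
pose g i w := \1_(idx k @^-1` [set i]) w * F i w.
have mg i : measurable_fun setT (g i).
  by apply: measurable_funM => //; exact: measurable_indic.
have g0 i w : 0 <= g i w.
  by apply: mulr_ge0; rewrite ?F0 ?indicE ?ler0n.
have r0 : 0 <= n%:R^-1 :> R by [].
have gE i : (\int[P]_w (g i w)%:E = n%:R^-1%:E * \int[P]_w (F i w)%:E)%E.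
  apply: (eq_integral_law (r := NngNum r0)) => // D mD D0.
  (* Off the event [g i] is 0, a value that [D] excludes. *)
  have -> : g i @^-1` D = idx k @^-1` [set i] `&` F i @^-1` D.
    rewrite eqEsubset; split => w /=; rewrite /g indicE.
      have [/set_mem ik|_] := boolP (w \in _); first by rewrite mul1r.
      by rewrite mul0r => /D0 /=; rewrite in_itv /= ltxx.
    by move=> [ik DF]; rewrite mem_set ?mul1r.
  by apply: probability_idx_tail; have /tail_measurableP := mF i; exact.
transitivity (\int[P]_w (\sum_(i <- enum 'I_n) (g i w)%:E))%E.
  apply: eq_integral => w _; rewrite sumEFin; congr EFin.
  rewrite big_enum /= (bigD1 (idx k w)) //= big1 ?addr0.
    by rewrite /g indicE mem_set ?mul1r.
  move=> i ik; rewrite /g indicE memNset ?mul0r //= => E.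
  by rewrite E eqxx in ik.
rewrite ge0_integral_sum //; [|by move=> i; exact/measurable_EFinP|
  by move=> i w _; rewrite lee_fin].
under eq_bigr do rewrite gE.
transitivity (\int[P]_w (n%:R^-1%:E * \sum_(i <- enum 'I_n) (F i w)%:E))%E.
  rewrite ge0_integralZl_EFin //; first last.
  - by apply: emeasurable_sum => i; exact/measurable_EFinP.
  - by move=> w _; apply: sume_ge0 => i _; rewrite lee_fin.
  rewrite ge0_integral_sum //; [|by move=> i; exact/measurable_EFinP|
    by move=> i w _; rewrite lee_fin].
  by rewrite ge0_sume_distrr // => i _; apply: integral_ge0 => w _; rewrite lee_fin.
by apply: eq_integral => w _; rewrite sumEFin -EFinM /mean big_enum.
Qed.

(** The latest draw is kept as a selection while the induction hypothesis averages the [N] earlier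
    ones. The result depends only on [idx N] and later draws, and [idx N] is averaged last. *)
Lemma integral_history N (F : seq 'I_n -> Omega -> R) :
  (forall s, tail_measurable N (F s)) -> (forall s w, 0 <= F s w) ->
  (\int[P]_w (F (history (idx ^~ w) N) w)%:E = \int[P]_w (wmean N (F ^~ w))%:E)%E.
Proof.
elim: N F => [//|N IH] F mF F0.
transitivity (\int[P]_w (wmean N (fun s => F (idx N w :: s) w))%:E)%E.
  rewrite -(IH (fun s w => F (idx N w :: s) w)) //.
    by apply: eq_integral => w _; rewrite historyS.
  move=> s; apply: (tail_measurable_select (F := fun i => F (i :: s))) => i.
  exact: tail_measurableS.
rewrite (integral_select (F := fun i w => wmean N (fun s => F (i :: s) w))).
- by apply: eq_integral => w _; congr EFin; rewrite /= -wmean_mean.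
- by move=> i; apply: (tail_measurable_wmean N (F := fun s => F (i :: s))).
- by move=> i w; exact: wmean_ge0.
Qed.

End Sampling.

(** * Matrices diagonal in an orthonormal basis *)

Section OrthogonalBasis.
Context {R : realType} {m : nat}.
Variable V : 'M[R]_m.
Hypothesis V_orth : V^T *m V = 1%:M.

Lemma orth_mulVK p (X : 'M[R]_(m, p)) : V *m (V^T *m X) = X.
Proof. by rewrite mulmxA (mulmx1C V_orth) mul1mx. Qed.

Lemma orth_mulKV p (X : 'M[R]_(m, p)) : V^T *m (V *m X) = X.
Proof. by rewrite mulmxA V_orth mul1mx. Qed.

Lemma enorm_sq p (x : 'cV[R]_p) : enorm x ^+ 2 = \sum_i x i 0 ^+ 2.
Proof. by rewrite /enorm sqr_sqrtr // sumr_ge0 // => i _; exact: sqr_ge0. Qed.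

Lemma enorm_orth_sq (x : 'cV[R]_m) : enorm (V^T *m x) ^+ 2 = enorm x ^+ 2.
Proof.
have E (y : 'cV[R]_m) : enorm y ^+ 2 = (y^T *m y) 0 0.
  by rewrite enorm_sq mxE; apply: eq_bigr => i _; rewrite mxE expr2.
by rewrite !E trmx_mul trmxK -mulmxA orth_mulVK.
Qed.

Definition vdiag (s : 'I_m -> R) : 'M[R]_m := V *m diag_mx (\row_j s j) *m V^T.

Lemma vdiagE s p (X : 'M[R]_(m, p)) j k :
  (V^T *m (vdiag s *m X)) j k = s j * (V^T *m X) j k.
Proof. by rewrite /vdiag -!mulmxA orth_mulKV mul_diag_mx !mxE. Qed.

Lemma vdiagM s t : vdiag s *m vdiag t = vdiag (fun j => s j * t j).
Proof.
rewrite /vdiag -!mulmxA orth_mulKV; congr (_ *m _); rewrite mulmxA mulmx_diag.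
by congr (diag_mx _ *m _); apply/rowP => j; rewrite !mxE.
Qed.

Lemma vdiag1 : vdiag (fun=> 1) = 1%:M.
Proof.
rewrite /vdiag; have -> : diag_mx (\row__ 1) = 1%:M :> 'M[R]_m.
  by apply/matrixP => i j; rewrite !mxE.
by rewrite mulmx1 (mulmx1C V_orth).
Qed.

Lemma vdiagD s t : vdiag s + vdiag t = vdiag (fun j => s j + t j).
Proof.
rewrite /vdiag -mulmxDl -mulmxDr -raddfD /=.
by congr (_ *m diag_mx _ *m _); apply/rowP => j; rewrite !mxE.
Qed.

Lemma vdiagZ c s : c *: vdiag s = vdiag (fun j => c * s j).
Proof.
rewrite /vdiag scalemxAl scalemxAr -linearZ /=.
by congr (_ *m diag_mx _ *m _); apply/rowP => j; rewrite !mxE.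
Qed.

Lemma tr_vdiag s : (vdiag s)^T = vdiag s.
Proof. by rewrite /vdiag !trmx_mul trmxK tr_diag_mx mulmxA. Qed.

Definition is_vdiag (T : 'M[R]_m) := exists s, T = vdiag s.

Lemma is_vdiagM S T : is_vdiag S -> is_vdiag T -> is_vdiag (S *m T).
Proof. by move=> [s ->] [t ->]; rewrite vdiagM; eexists. Qed.

Lemma is_vdiagD S T : is_vdiag S -> is_vdiag T -> is_vdiag (S + T).
Proof. by move=> [s ->] [t ->]; rewrite vdiagD; eexists. Qed.

Lemma is_vdiagZ c T : is_vdiag T -> is_vdiag (c *: T).
Proof. by move=> [t ->]; rewrite vdiagZ; eexists. Qed.

Lemma is_vdiagB S T : is_vdiag S -> is_vdiag T -> is_vdiag (S - T).
Proof.
by move=> vS vT; rewrite -scaleN1r; apply: is_vdiagD => //; exact: is_vdiagZ.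
Qed.

Lemma is_vdiag1 : is_vdiag 1%:M.
Proof. by exists (fun=> 1); rewrite vdiag1. Qed.

Lemma is_vdiag_prod (I : Type) (r : seq I) (F : I -> 'M[R]_m) :
  (forall i, is_vdiag (F i)) -> is_vdiag (\big[mulmx/1%:M]_(i <- r) F i).
Proof.
by move=> vF; elim/big_ind: _ => //; [exact: is_vdiag1|exact: is_vdiagM].
Qed.

Lemma mp_inverse_vdiag s :
  vdiag s *m mp_inverse (vdiag s) *m vdiag s = vdiag s.
Proof.
have : is_moore_penrose (vdiag s) (mp_inverse (vdiag s)).
  (* Entrywise inversion with the convention 0^-1 = 0 satisfies the Penrose equations, and this
     existence rules out the default value of [xget]. *)
  apply: (xgetPex 0); exists (vdiag (fun j => (s j)^-1)).
  split; rewrite ?vdiagM ?tr_vdiag //; congr vdiag; apply/funext => j;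
    by have [->|sj] := eqVneq (s j) 0; rewrite ?invr0 ?mul0r ?mulr0 // ?divff //
      ?mulVf // mul1r.
by case.
Qed.

(** The hypothesis puts [v] in the range of D = [vdiag s], and the first Penrose equation D X D = D
    then gives the claim. *)
Lemma mul_mp_inverse s (v : 'cV[R]_m) :
  (forall j, s j = 0 -> (V^T *m v) j 0 = 0) ->
  vdiag s *m (mp_inverse (vdiag s) *m v) = v.
Proof.
move=> sv; have -> : v = vdiag s *m (vdiag (fun j => (s j)^-1) *m v).
  rewrite -[LHS]orth_mulVK -[RHS]orth_mulVK; congr (V *m _).
  apply/matrixP => j k; rewrite (ord1 k) !vdiagE mulrA.
  have [sj|sj] := eqVneq (s j) 0; first by rewrite sv // mulr0.
  by rewrite divff // mul1r.
move: (vdiag s) (vdiag _) (mp_inverse_vdiag s) => D E DXD.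
by rewrite !mulmxA DXD.
Qed.

(** In the coordinates of [V], which preserve the norm, each entry is scaled by at most [C]. The
    zero vector gives the lower bound and the nonemptiness that the supremum requires. *)
Lemma opnorm_vdiag_bounds s (C : R) : 0 <= C -> (forall j, 0 <= s j <= C) ->
  0 <= opnorm (vdiag s) <= C.
Proof.
move=> C0 sC.
have bd x : enorm x <= 1 -> enorm (vdiag s *m x) <= C.
  move=> x1; rewrite -(@ler_pXn2r _ 2) ?nnegrE ?sqrtr_ge0 //.
  apply: (@le_trans _ _ (C ^+ 2 * enorm x ^+ 2)).
    rewrite -(enorm_orth_sq x) -(enorm_orth_sq (vdiag s *m x)).
    rewrite !enorm_sq mulr_sumr; apply: ler_sum => j _.
    rewrite vdiagE exprMn ler_wpM2r ?sqr_ge0 //.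
    by have /andP[s0 sjC] := sC j; rewrite ler_pXn2r ?nnegrE.
  rewrite -[leRHS]mulr1 ler_wpM2l ?sqr_ge0 // expr_le1 // sqrtr_ge0 //.
have e0 p : enorm (0 : 'cV[R]_p) = 0.
  rewrite /enorm big1 ?sqrtr0 // => i _.
  by rewrite mxE expr0n.
have in0 : [set enorm (vdiag s *m x) | x in [set x | enorm x <= 1]] 0.
  by exists 0; rewrite /= ?mulmx0 ?e0.
have ubC : ubound [set enorm (vdiag s *m x) | x in [set x | enorm x <= 1]] C.
  by move=> _ [x x1 <-]; exact: bd.
apply/andP; split; first by apply: ub_le_sup => //; exists C.
by apply: ge_sup => //; exists 0.
Qed.

End OrthogonalBasis.

(** The same refresh rule as for the reference in [svrg_state]. *)
Lemma epoch_startS M k : (0 < M)%N ->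
  epoch_start M k.+1 = if (M %| k.+1)%N then k.+1 else epoch_start M k.
Proof.
move=> M0; rewrite /epoch_start; case: ifPn => [/divnK //|Mk].
by rewrite divnS // (negbTE Mk).
Qed.

Section ColumnEntries.
Context {R : realType} {p q : nat}.
Implicit Types (T : 'M[R]_(p, q)) (u v : 'cV[R]_q).

Lemma mulmxDE T u v j : (T *m (u + v)) j 0 = (T *m u) j 0 + (T *m v) j 0.
Proof. by rewrite mulmxDr [LHS]mxE. Qed.

Lemma mulmxZE T c u j : (T *m (c *: u)) j 0 = c * (T *m u) j 0.
Proof. by rewrite -scalemxAr [LHS]mxE. Qed.

Lemma mulmxBE T u v j : (T *m (u - v)) j 0 = (T *m u) j 0 - (T *m v) j 0.
Proof. by rewrite -scaleN1r mulmxDE mulmxZE mulN1r. Qed.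

End ColumnEntries.

(** * Least squares when A is diagonal in the basis V *)

Section DiagonalLeastSquares.
Context {R : realType} {n m : nat}.
Variables (A Sigma : 'M[R]_(n, m)) (V : 'M[R]_m).
Hypothesis Sigma_diag : is_diag_mx Sigma.
Hypothesis V_orth : V^T *m V = 1%:M.
Hypothesis A_svd : A = Sigma *m V^T.

Lemma Sigma_eq0 (i : 'I_n) (j : 'I_m) : val i != val j -> Sigma i j = 0.
Proof. by move=> ij; move/is_diag_mxP: Sigma_diag; apply. Qed.

Lemma arow_svd i : arow A i = V *m (row i Sigma)^T.
Proof. by rewrite /arow A_svd row_mul trmx_mul trmxK. Qed.

(** A row of a rectangular diagonal matrix has at most one nonzero entry. This makes all the outer
    products of rows of [A] diagonal in one basis. *)
Lemma Sigma_mul_eq0 (j l : 'I_m) : j != l ->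
  forall i, Sigma i j * Sigma i l = 0.
Proof.
move=> jl i; have [ij|ij] := eqVneq (val i) (val j).
  by rewrite (Sigma_eq0 (j := l)) ?mulr0 // ij.
by rewrite Sigma_eq0 ?mul0r.
Qed.

Lemma arow_outer i :
  arow A i *m (arow A i)^T = vdiag V (fun j => Sigma i j ^+ 2).
Proof.
rewrite arow_svd trmx_mul trmxK /vdiag !mulmxA; congr (_ *m _).
rewrite -mulmxA; congr (_ *m _); apply/matrixP => j l.
rewrite !mxE big_ord1 !mxE; case: eqVneq => [->|jl]; first by rewrite expr2 mulr1n.
by rewrite mulr0n Sigma_mul_eq0.
Qed.

Lemma Bmat_vdiag : Bmat A = vdiag V (fun j => mean (fun i => Sigma i j ^+ 2)).
Proof.
rewrite /Bmat A_svd trmx_mul trmxK /vdiag !mulmxA scalemxAl; congr (_ *m _).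
rewrite -mulmxA scalemxAr; congr (_ *m _); apply/matrixP => j l.
rewrite !mxE; case: eqVneq => [->|jl].
  rewrite mulr1n /mean; congr (_ * _); apply: eq_bigr => i _; rewrite !mxE. by rewrite expr2.
by rewrite mulr0n big1 ?mulr0 // => i _; rewrite !mxE Sigma_mul_eq0.
Qed.

Lemma tr_mul_arow i j : (V^T *m arow A i) j 0 = Sigma i j.
Proof. by rewrite arow_svd orth_mulKV // !mxE. Qed.

Lemma zeta_coord xi j :
  (V^T *m zeta A xi) j 0 = mean (fun i => Sigma i j * xi i 0).
Proof.
rewrite /zeta A_svd trmx_mul trmxK -scalemxAr -mulmxA orth_mulKV // !mxE.
by congr (_ * _); apply: eq_bigr => i _; rewrite !mxE.
Qed.

Lemma innerE p (a x : 'cV[R]_p) : inner a x *: a = a *m a^T *m x.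
Proof.
apply/matrixP => j k; rewrite (ord1 k) -mulmxA !mxE big_ord1 mulrC; congr (_ * _).
by rewrite mxE; apply: eq_bigr => l _; rewrite mxE.
Qed.

Lemma mean_Sigma_sq_eq0 j : (0 < n)%N ->
  mean (fun i => Sigma i j ^+ 2) = 0 -> forall i, Sigma i j = 0.
Proof.
move=> n0 /eqP; rewrite mulf_eq0 invr_eq0 pnatr_eq0 -leqn0 leqNgt n0 /=.
rewrite psumr_eq0 => [/allP H i|i _]; last exact: sqr_ge0.
by have := H i (mem_index_enum _); rewrite sqrf_eq0 => /eqP.
Qed.

(** Where an eigenvalue of [Bmat A] vanishes, so does the whole column of [Sigma], and with it the
    coordinate of [zeta A xi]. *)
Lemma Bmat_mp_zeta xi : (0 < n)%N ->
  Bmat A *m (mp_inverse (Bmat A) *m zeta A xi) = zeta A xi.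
Proof.
move=> n0; rewrite Bmat_vdiag mul_mp_inverse // => j /mean_Sigma_sq_eq0 Sj.
by rewrite zeta_coord /mean big1 ?mulr0 // => i _; rewrite Sj ?mul0r.
Qed.

(* The noise of a single sample vanishes at the least-squares solution, which
   is special to the diagonal case. *)
Lemma sgd_noise_free xi (b : 'cV[R]_m) i : (0 < n)%N ->
  Bmat A *m b = zeta A xi -> (inner (arow A i) b - xi i 0) *: arow A i = 0.
Proof.
move=> n0 bE; rewrite scalerBl innerE; apply/eqP; rewrite subr_eq0; apply/eqP.
rewrite -[LHS](orth_mulVK V_orth) -[RHS](orth_mulVK V_orth); congr (V *m _).
apply/matrixP => j k; rewrite (ord1 k) arow_outer vdiagE //.
rewrite mulmxZE !tr_mul_arow.
have [ij|ij] := eqVneq (val i) (val j); last first.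
  by rewrite Sigma_eq0 // expr0n mul0r mulr0.
(* Column [j] is zero outside row [i], so both averages in the normal equation reduce to one
   term. *)
have one (F : 'I_n -> R) : (forall i', Sigma i' j = 0 -> F i' = 0) ->
    mean F = n%:R^-1 * F i.
  move=> F0; rewrite /mean (bigD1 i) //= big1 ?addr0 // => i' i'i.
  by apply/F0/Sigma_eq0; rewrite -ij.
have := congr1 (fun v : 'cV[R]_m => (V^T *m v) j 0) bE.
rewrite Bmat_vdiag vdiagE // zeta_coord !one; first last.
- by move=> i' ->; rewrite expr0n.
- by move=> i' ->; rewrite mul0r.
rewrite -mulrA => /(mulfI _) -> //; first by rewrite mulrC.
by rewrite invr_eq0 pnatr_eq0 -lt0n.
Qed.

Section Iterates.
Variables (c0 : R) (M : nat) (xdag b : 'cV[R]_m) (ydag xi : 'cV[R]_n).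
Variables (x0 : 'cV[R]_m) (idx : nat -> 'I_n).
Hypotheses (n_gt0 : (0 < n)%N) (M_gt0 : (0 < M)%N).
Hypothesis xdagE : A *m xdag = ydag.
Hypothesis bE : Bmat A *m b = zeta A xi.

Let h j i := c0 * Sigma i j ^+ 2.
(** The error relative to [xdag + b], where the gradient of the noisy functional vanishes. With this
    centre both recursions become homogeneous. *)
Let err (v : 'cV[R]_m) := (v - xdag) - b.

Lemma gradJ_err v : gradJ A (ydag + xi) v = Bmat A *m err v.
Proof.
rewrite /gradJ /err (mulmxBr (Bmat A)) bE /Bmat /zeta -scalemxAl -scalerBr; congr (_ *: _).
by rewrite -mulmxA -mulmxBr; congr (_ *m _); rewrite mulmxBr xdagE opprD addrA.
Qed.

Lemma svrg_err_coord x : svrg_iterates A (ydag + xi) x0 c0 M idx x ->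
  forall k j, (V^T *m err (x k)) j 0 =
    svrg_coord M (h j) ((V^T *m err x0) j 0) (history idx k).
Proof.
move=> [x_0 xS] k j.
set z := (V^T *m err x0) j 0.
(* The update refers to the epoch-start iterate, so the induction carries it along. *)
suff : (V^T *m err (x k)) j 0 = svrg_coord M (h j) z (history idx k) /\
       (V^T *m err (x (epoch_start M k))) j 0 = svrg_ref M (h j) z (history idx k).
  by case.
elim: k => [|k [IHx IHr]]; first by rewrite /epoch_start div0n mul0n x_0.
have uS : (V^T *m err (x k.+1)) j 0 = svrg_coord M (h j) z (history idx k.+1).
  rewrite historyS svrg_coord_cons -IHx -IHr xS gradJ_err innerE.
  set r := x (epoch_start M k).
  have -> : x k - r = err (x k) - err r.
    by rewrite /err; apply/matrixP => ? ?; rewrite !mxE; ring.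
  set E := _ + Bmat A *m _.
  have -> : err (x k - c0 *: E) = err (x k) - c0 *: E.
    by rewrite /err; apply/matrixP => ? ?; rewrite !mxE; ring.
  rewrite /E; move: (err (x k)) (err r) => u v.
  rewrite mulmxBE mulmxZE mulmxDE arow_outer Bmat_vdiag !vdiagE // mulmxBE.
  rewrite /h meanZ; ring.
split=> //; rewrite epoch_startS // historyS svrg_ref_cons size_history.
by case: ifP => _ //; rewrite -historyS.
Qed.

Lemma sgd_err_coord x : sgd_iterates A (ydag + xi) x0 c0 idx x ->
  forall k j, (V^T *m err (x k)) j 0 =
    sgd_coord (h j) ((V^T *m err x0) j 0) (history idx k).
Proof.
move=> [x_0 xS] k j; elim: k => [|k IH]; first by rewrite x_0.
rewrite historyS /= -IH xS.
set a := arow A (idx k).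
have -> : (inner a (x k) - (ydag + xi) (idx k) 0) *: a = a *m a^T *m err (x k).
  have yE : ydag (idx k) 0 = inner a xdag.
    by rewrite -xdagE mxE; apply: eq_bigr => l _; rewrite !mxE.
  have innerB u v : inner a (u - v) = inner a u - inner a v.
    by rewrite /inner -sumrB; apply: eq_bigr => l _; rewrite !mxE mulrBr.
  rewrite -innerE /err !innerB -yE [(ydag + xi) _ _]mxE.
  (* The residual of [b] on this sample, zero along [a], is added to turn the noisy update into one
     linear in the error. *)
  have := sgd_noise_free (idx k) n_gt0 bE; rewrite -/a => noise.
  rewrite -[RHS]addr0 -noise -scalerDl; congr (_ *: _); ring.
rewrite arow_outer; set E := vdiag _ _ *m _.
have -> : err (x k - c0 *: E) = err (x k) - c0 *: E.
  by rewrite /err; apply/matrixP => ? ?; rewrite !mxE; ring.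
rewrite /E; move: (err (x k)) => u.
by rewrite mulmxBE mulmxZE vdiagE // /h; ring.
Qed.

End Iterates.

Lemma is_vdiag_outer i : is_vdiag V (arow A i *m (arow A i)^T).
Proof. by rewrite arow_outer; eexists. Qed.

Lemma is_vdiag_Bmat : is_vdiag V (Bmat A).
Proof. by rewrite Bmat_vdiag; eexists. Qed.

Lemma is_vdiag_Pmat c0 i k : is_vdiag V (Pmat A c0 i k).
Proof.
apply: is_vdiagB; first exact: is_vdiag1.
by apply: is_vdiagZ; exact: is_vdiag_outer.
Qed.

Lemma is_vdiag_Hmat c0 M i k : is_vdiag V (Hmat A c0 M i k).
Proof.
apply: is_vdiagM => //; last first.
  by apply: is_vdiagB; [exact: is_vdiag_Bmat|exact: is_vdiag_outer].
rewrite /Gmat; case: ifP => _; first exact: is_vdiag1.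
by apply: is_vdiag_prod => // j; exact: is_vdiag_Pmat.
Qed.

Lemma is_vdiag_combination (T : Type) c0 M (idx : nat -> T -> 'I_n) R1 w :
  combination_M0_H A c0 M idx R1 -> is_vdiag V (R1 w).
Proof.
move=> [s ->]; elim/big_ind: _ => [||t _].
- by rewrite -(scale0r 1%:M); apply: is_vdiagZ; exact: is_vdiag1.
- exact: is_vdiagD.
apply: is_vdiagZ; apply: is_vdiag_prod => // -[k|]; first exact: is_vdiag_Hmat.
apply: is_vdiagB; first exact: is_vdiag1.
by apply: is_vdiagZ; exact: is_vdiag_Bmat.
Qed.

(** * Bounds on the random step and its mean *)

Section StepSize.
Variable c0 : R.
Hypotheses (n_gt0 : (0 < n)%N) (c0_gt0 : 0 < c0).
Hypothesis c0_le : c0 * max_row_norm2 A <= 1.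

Let h j i := c0 * Sigma i j ^+ 2.

(** [Sigma i j] is a coordinate of [arow A i] in an orthonormal basis, hence bounded by its norm. *)
Lemma step_le1 i j : h j i <= 1.
Proof.
apply: le_trans c0_le; rewrite /h; apply: ler_wpM2l; first exact: ltW.
apply: (@le_trans _ _ (enorm (arow A i) ^+ 2)); last exact: le_bigmax.
rewrite -(enorm_orth_sq V_orth) enorm_sq (bigD1 j) //= tr_mul_arow lerDl.
by apply: sumr_ge0 => l _; exact: sqr_ge0.
Qed.

Lemma step_ge0 i j : 0 <= h j i.
Proof. by rewrite /h mulr_ge0 ?sqr_ge0 ?ltW. Qed.

(** A column of [Sigma] has at most one nonzero entry, so the average has a single term, of size at
    most 1; hence the 1/n. *)
Lemma mean_step_bounds j : 0 <= mean (h j) <= n%:R^-1.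
Proof.
apply/andP; split.
  by rewrite /mean mulr_ge0 ?invr_ge0 // sumr_ge0 // => i _; exact: step_ge0.
rewrite /mean -[leRHS]mulr1 ler_wpM2l ?invr_ge0 //.
(* If [m] exceeds [n], column [j] may have no diagonal entry at all. *)
have [/existsP[i /eqP ij]|/existsPn noi] :=
    boolP [exists i : 'I_n, val i == val j].
  rewrite (bigD1 i) //= big1 ?addr0 ?step_le1 // => i' i'i.
  by rewrite /h Sigma_eq0 ?expr0n ?mulr0 // -ij.
by rewrite big1 // => i _; rewrite /h Sigma_eq0 ?expr0n ?mulr0 ?noi.
Qed.

(** The eigenvalues of [Bmat A] times [c0] are the mean steps. The bounds serve to show that the
    inverse of [cB] is at most 1. *)
Lemma step_opnorm_bounds : 0 <= c0 * opnorm (Bmat A) <= 1.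
Proof.
have /andP[B0 B1] : 0 <= opnorm (Bmat A) <= c0^-1.
  rewrite Bmat_vdiag; apply: opnorm_vdiag_bounds => [||j] //.
    by rewrite invr_ge0 ltW.
  have /andP[] := mean_step_bounds j; rewrite /h meanZ => m0 m1.
  rewrite -(pmulr_rge0 _ c0_gt0) m0 /= -[leRHS]mul1r ler_pdivlMr // mulrC.
  by apply: le_trans m1 _; rewrite invf_le1 ?ltr0n // ler1n.
rewrite mulr_ge0 ?(ltW c0_gt0) //=.
by have := ler_wpM2l (ltW c0_gt0) B1; rewrite divff // gt_eqF.
Qed.

(** Bernoulli's inequality reduces the claim to (M - 1) q <= 1/2 for the mean step q. Since q <= 1/n
    and the inverse of [cB] is at most 1, the hypothesis yields 2 (M + 1)^2 <= n - 1, which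
    suffices. *)
Lemma mean_step_half M j : (0 < M)%N ->
  (M%:R + 1) ^+ 2 <= (2 * cB A c0 M)^-1 * (n%:R - 1) ->
  1 / 2 <= (1 - mean (h j)) ^+ M.-1.
Proof.
move=> M0 hM.
have /andP[q0 qn] := mean_step_bounds j.
have n1 : 1 <= n%:R :> R by rewrite ler1n.
have q1 : mean (h j) <= 1.
  by apply: le_trans qn _; rewrite invf_le1 ?ltr0n.
have bern k : 1 - k%:R * mean (h j) <= (1 - mean (h j)) ^+ k.
  elim: k => [|k IH]; first by rewrite mul0r subr0 expr0.
  rewrite exprS; apply: le_trans (ler_wpM2l _ IH); last by rewrite subr_ge0.
  have : 0 <= k%:R * mean (h j) ^+ 2 by rewrite mulr_ge0 ?sqr_ge0.
  by rewrite -natr1; lra.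
apply: le_trans (bern _).
have Mn : 2 * (M%:R + 1) ^+ 2 <= n%:R - 1 :> R.
  have /andP[b0 b1] := step_opnorm_bounds.
  have : (2 * cB A c0 M)^-1 <= 2^-1.
    by rewrite /cB invfM invrK ger_pMr ?invr_gt0 // exprn_ile1 // ?subr_ge0 ?gerBl.
  have n10 : 0 <= n%:R - 1 :> R by rewrite subr_ge0.
  by move=> /(ler_wpM2r n10) /(le_trans hM); lra.
have MM : M.-1%:R <= M%:R :> R by rewrite ler_nat leq_pred.
have M1 : 0 <= M%:R :> R by [].
have : M.-1%:R * mean (h j) <= M.-1%:R * n%:R^-1 by rewrite ler_wpM2l.
have : M.-1%:R * n%:R^-1 <= 1 / 2 :> R by rewrite ler_pdivrMr ?ltr0n //; nra.
lra.
Qed.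

End StepSize.

End DiagonalLeastSquares.

Theorem theorem2p2 (R : realType) (n m M : nat)
    (n_gt0 : (0 < n)%N) (m_gt0 : (0 < m)%N) (M_gt0 : (0 < M)%N)
    (A : 'M[R]_(n, m)) (x0 xdag : 'cV[R]_m) (ydag xi : 'cV[R]_n)
    (ydag_range : exists x, A *m x = ydag)
    (xdag_min : min_dist_solution A x0 ydag xdag)
    (B_le1 : opnorm (Bmat A) <= 1)
    (d : measure_display) (Omega : measurableType d) (P : probability Omega R)
    (idx : nat -> Omega -> 'I_n) (idx_iid : iid_uniform P idx)
    (c0 : R) (c0_gt0 : 0 < c0)
    (* c0 <= (max (max_i |a_i|^2) |B|^2)^-1, which is no constraint if A = 0 *)
    (c0_le : c0 * Num.max (max_row_norm2 A) (opnorm (Bmat A) ^+ 2) <= 1)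
    (Sigma : 'M[R]_(n, m)) (V : 'M[R]_m)
    (Sigma_diag : is_diag_mx Sigma) (Sigma_ge0 : forall i j, 0 <= Sigma i j)
    (V_orth : V^T *m V = 1%:M) (A_svd : A = Sigma *m V^T)
    (hM1 : (M%:R - 1) ^+ 2 * c0 ^+ 2 * opnorm (Bmat A) ^+ 2
           <= (2 * cB A c0 M)^-1)
    (hM2 : (M%:R + 1) ^+ 2 <= (2 * cB A c0 M)^-1 * (n%:R - 1))
    (x xhat : nat -> Omega -> 'cV[R]_m)
    (x_svrg : forall w,
       svrg_iterates A (ydag + xi) x0 c0 M (idx ^~ w) (x ^~ w))
    (xhat_sgd : forall w,
       sgd_iterates A (ydag + xi) x0 c0 (idx ^~ w) (xhat ^~ w))
    (K : nat) (R1 : Omega -> 'M[R]_m) (R2 : Omega -> 'cV[R]_m)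
    (R1_tail : measurable_mx_wrt (tail_sigma idx (K * M)) R1)
    (R2_tail : measurable_mx_wrt (tail_sigma idx (K * M)) R2)
    (R1_comb : combination_M0_H A c0 M idx R1) :
  let b := mp_inverse (Bmat A) *m zeta A xi in
  ('E_P[fun w => (enorm (R1 w *m ((x (K * M)%N w - xdag) - b) + R2 w) ^+ 2)%R]
   <= 'E_P[fun w =>
        (enorm (R1 w *m ((xhat (K * M)%N w - xdag) - b) + R2 w) ^+ 2)%R])%E.
Proof.
set b := mp_inverse (Bmat A) *m zeta A xi; cbv zeta.
have xdagE : A *m xdag = ydag by case: xdag_min.
have bE : Bmat A *m b = zeta A xi.
  exact: (Bmat_mp_zeta Sigma_diag V_orth A_svd).
have row_le : c0 * max_row_norm2 A <= 1.
  by apply: le_trans c0_le; rewrite ler_pM2l // le_max lexx.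
pose h j i := c0 * Sigma i j ^+ 2.
pose z j := (V^T *m (x0 - xdag - b)) j 0.
(* The eigenvalue of [R1 w] on the [j]-th column of [V], written as a matrix entry so that its
   measurability follows from that of [R1]. *)
pose coef w j := (V^T *m R1 w *m V) j j.
pose shift w j := (V^T *m R2 w) j 0.
pose F (c : 'I_m -> seq 'I_n -> R) s w :=
  \sum_(j <- enum 'I_m) (coef w j * c j s + shift w j) ^+ 2.
have normE u w :
    enorm (R1 w *m u + R2 w) ^+ 2 =
    \sum_(j <- enum 'I_m) (coef w j * (V^T *m u) j 0 + shift w j) ^+ 2.
  rewrite -(enorm_orth_sq V_orth) enorm_sq big_enum; apply: eq_bigr => j _.
  have [s sE] := is_vdiag_combination Sigma_diag V_orth A_svd w R1_comb.
  rewrite mulmxDE /coef -mulmxA sE !vdiagE // V_orth [1%:M _ _]mxE eqxx.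
  by rewrite mulr1.
have tail_mx_meas p (X : Omega -> 'M[R]_(m, p)) (L : 'rV[R]_m) (Q : 'cV[R]_p) :
    measurable_mx_wrt (tail_sigma idx (K * M)) X ->
    tail_measurable idx (K * M) (fun w => (L *m X w *m Q) 0 0).
  move=> mX; pose s := [seq (i, j) | i <- enum 'I_m, j <- enum 'I_p].
  have -> : (fun w => (L *m X w *m Q) 0 0) =
      (fun w => \sum_(ij <- s) (L 0 ij.1 * Q ij.2 0) * X w ij.1 ij.2).
    apply/funext => w; rewrite /s big_allpairs /= exchange_big big_enum mxE /=.
    apply: eq_bigr => j _; rewrite mxE mulr_suml big_enum /=; apply: eq_bigr => i _.
    by rewrite mulrAC.
  apply: measurable_sum => ij; apply: measurable_funM; first exact: measurable_cst.
  by apply/tail_measurableP; exact: mX.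
have mcoef j : tail_measurable idx (K * M) (coef ^~ j).
  have -> : coef ^~ j = fun w => (row j V^T *m R1 w *m col j V) 0 0.
    apply/funext => w; rewrite /coef -row_mul mxE [RHS]mxE.
    by apply: eq_bigr => k _; rewrite [row _ _ _ _]mxE [col _ _ _ _]mxE.
  exact: tail_mx_meas.
have mshift j : tail_measurable idx (K * M) (shift ^~ j).
  have -> : shift ^~ j = fun w => (row j V^T *m R2 w *m 1%:M) 0 0.
    by apply/funext => w; rewrite mulmx1 -row_mul [RHS]mxE.
  exact: tail_mx_meas.
have mF c s : tail_measurable idx (K * M) (F c s).
  apply: measurable_sum => j; apply: measurable_funX.
  apply: measurable_funD; last exact: mshift.
  by apply: measurable_funM; [exact: mcoef|exact: measurable_cst].
have F0 c s w : 0 <= F c s w.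
  by apply: sumr_ge0 => j _; exact: sqr_ge0.
have svrgE : (fun w => enorm (R1 w *m (x (K * M)%N w - xdag - b) + R2 w) ^+ 2) =
    (fun w => F (fun j => svrg_coord M (h j) (z j)) (history (idx ^~ w) (K * M)) w).
  apply/funext => w; rewrite normE; apply: eq_bigr => j _.
  by rewrite (svrg_err_coord Sigma_diag V_orth A_svd M_gt0 xdagE bE (x_svrg w)).
have sgdE : (fun w => enorm (R1 w *m (xhat (K * M)%N w - xdag - b) + R2 w) ^+ 2) =
    (fun w => F (fun j => sgd_coord (h j) (z j)) (history (idx ^~ w) (K * M)) w).
  apply/funext => w; rewrite normE; apply: eq_bigr => j _.
  by rewrite (sgd_err_coord Sigma_diag V_orth A_svd n_gt0 xdagE bE (xhat_sgd w)).
(* The first [K * M] draws are averaged out with [coef] and [shift] frozen, as these depend only on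
   the remaining draws. *)
rewrite svrgE sgdE unlock !(integral_history idx_iid) //.
have mwF c : measurable_fun setT (fun w => wmean (K * M) (F c ^~ w)).
  by apply: (tail_measurableW idx_iid); exact: (tail_measurable_wmean _ (mF c)).
apply: ge0_le_integral => //.
- by move=> w _; rewrite lee_fin wmean_ge0.
- exact/measurable_EFinP.
- exact/measurable_EFinP.
move=> w _; rewrite lee_fin /F !wmean_sum; apply: ler_sum => j _.
have /andP[q0 qn] := mean_step_bounds Sigma_diag V_orth A_svd c0_gt0 row_le j.
apply: wmean_affine_sq_le => //.
- exact: (mean_step_half Sigma_diag V_orth A_svd).
- by apply: le_trans qn _; rewrite invf_le1 ?ltr0n // ler1n.
Qed.
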